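(* The following are equivalent for any distributive $\ell$-monoid $\mathbf{M}$: (1) $\mathbf{M}$ is representable. (2) $\mathbf{M}$ satisfies the quasiequation $(x_1\le x_2\vee z_1y_1z_2)\ \&\ (x_1\le x_2\vee w_1y_2w_2)\ \Longrightarrow\ x_1\le x_2\vee z_1y_2z_2\vee w_1y_1w_2$. (3) $\mathbf{M}$ satisfies the equation $z_1y_1z_2\wedge w_1y_2w_2\le z_1y_2z_2\vee w_1y_1w_2$. (4) For any prime lattice ideal $I$ of $\mathbf{M}$, the quotient $\mathbf{M}/I$ is totally ordered.
   Context: A distributive $\ell$-monoid is an algebraic structure $\langle M,\wedge,\vee,\cdot,\mathrm{e}\rangle$ such that $\langle M,\cdot,\mathrm{e}\rangle$ is a monoid, $\langle M,\wedge,\vee\rangle$ is a distributive lattice, and for all $a,b,c,d\in M$, $a(b\vee c)d=abd\vee acd$ and $a(b\wedge c)d=abd\wedge acd$; $a\le b$ means $a\wedge b=a$. A totally ordered monoid is a distributive $\ell$-monoid whose lattice order is total. A distributive $\ell$-monoid is representable if it is isomorphic to a subdirect product of totally ordered monoids. For terms $s,t$, $s\le t$ abbreviates the equation $s\wedge t\approx s$; equations and quasiequations are implicitly universally quantified over their variables. For a prime lattice ideal $I$ of (the lattice reduct of) $\mathbf{M}$ and $a,b\in M$, let $\tfrac{I}{a}:=\{\langle c,d\rangle\in M\times M\mid cad\in I\}$ and let $a\sim_I b$ if and only if $\tfrac{I}{a}=\tfrac{I}{b}$. The relation $\sim_I$ is a congruence of $\mathbf{M}$ (a known fact), and $\mathbf{M}/I$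 denotes the quotient distributive $\ell$-monoid $\mathbf{M}/{\sim_I}$. *)

(* Defs.v *)
From HB Require Import structures.
From mathcomp Require Import all_boot all_order.
From mathcomp Require Import boolp classical_sets.

Set Implicit Arguments.
Unset Strict Implicit.
Unset Printing Implicit Defensive.

Import Order.Theory.
Local Open Scope order_scope.
Local Open Scope group_scope.
Local Open Scope quotient_scope.

(* Orders and equality are boolean, so carriers are choiceTypes; classically
   (axioms of boolp) every type is one. *)

HB.mixin Record isDLMonoid (d : Order.disp_t) M
    of Monoid M & Order.DistrLattice d M := {
  mulg_join : forall a b c e : M,
    a * (b `|` c) * e = (a * b * e) `|` (a * c * e);
  mulg_meet : forall a b c e : M,
    a * (b `&` c) * e = (a * b * e) `&` (a * c * e)
}.

#[short(type="dlMonoidType")]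
HB.structure Definition DLMonoid (d : Order.disp_t) :=
  { M of Monoid M & Order.DistrLattice d M & isDLMonoid d M }.

#[short(type="totalMonoidType")]
HB.structure Definition TotalMonoid (d : Order.disp_t) :=
  { M of DLMonoid d M & Order.Total d M }.

Definition dlmonoid_morphism (d d' : Order.disp_t) (M : dlMonoidType d)
    (N : dlMonoidType d') (f : M -> N) : Prop :=
  [/\ monoid_morphism f, Order.meet_morphism f & Order.join_morphism f].

Section DirectProduct.
Context {d : Order.disp_t} {I : Type} (T : I -> dlMonoidType d).

Definition dlprod : Type := forall i, T i.

HB.instance Definition _ := gen_eqMixin dlprod.
HB.instance Definition _ := gen_choiceMixin dlprod.

Implicit Types x y z : dlprod.

Definition dlprod_mul x y : dlprod := fun i => x i * y i.
Definition dlprod_one : dlprod := fun i => 1.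
Definition dlprod_meet x y : dlprod := fun i => x i `&` y i.
Definition dlprod_join x y : dlprod := fun i => x i `|` y i.
Definition dlprod_le x y : bool := dlprod_meet x y == x.
Definition dlprod_lt x y : bool := (y != x) && dlprod_le x y.

Fact dlprod_mulA : associative dlprod_mul.
Proof. by move=> x y z; apply: functional_extensionality_dep => i; apply: mulgA. Qed.
Fact dlprod_mul1 : left_id dlprod_one dlprod_mul.
Proof. by move=> x; apply: functional_extensionality_dep => i; apply: mul1g. Qed.
Fact dlprod_mulr1 : right_id dlprod_one dlprod_mul.
Proof. by move=> x; apply: functional_extensionality_dep => i; apply: mulg1. Qed.

HB.instance Definition _ :=
  isMonoid.Build dlprod dlprod_mulA dlprod_mul1 dlprod_mulr1.

Fact dlprod_meetC : commutative dlprod_meet.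
Proof. by move=> x y; apply: functional_extensionality_dep => i; apply: meetC. Qed.
Fact dlprod_joinC : commutative dlprod_join.
Proof. by move=> x y; apply: functional_extensionality_dep => i; apply: joinC. Qed.
Fact dlprod_meetA : associative dlprod_meet.
Proof. by move=> x y z; apply: functional_extensionality_dep => i; apply: meetA. Qed.
Fact dlprod_joinA : associative dlprod_join.
Proof. by move=> x y z; apply: functional_extensionality_dep => i; apply: joinA. Qed.
Fact dlprod_joinKI y x : dlprod_meet x (dlprod_join x y) = x.
Proof. by apply: functional_extensionality_dep => i; apply: joinKI. Qed.
Fact dlprod_meetKU y x : dlprod_join x (dlprod_meet x y) = x.
Proof. by apply: functional_extensionality_dep => i; apply: meetKU. Qed.
Fact dlprod_meetUl : left_distributive dlprod_meet dlprod_join.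
Proof. by move=> x y z; apply: functional_extensionality_dep => i; apply: meetUl. Qed.
Fact dlprod_meetxx : idempotent_op dlprod_meet.
Proof. by move=> x; apply: functional_extensionality_dep => i; apply: meetxx. Qed.

HB.instance Definition _ :=
  Order.isMeetJoinDistrLattice.Build d dlprod
    (fun _ _ => erefl) (fun _ _ => erefl) dlprod_meetC dlprod_joinC
    dlprod_meetA dlprod_joinA dlprod_joinKI dlprod_meetKU dlprod_meetUl
    dlprod_meetxx.

Fact dlprod_mulg_join (a b c e : dlprod) :
  a * (b `|` c) * e = (a * b * e) `|` (a * c * e).
Proof. by apply: functional_extensionality_dep => i; apply: mulg_join. Qed.
Fact dlprod_mulg_meet (a b c e : dlprod) :
  a * (b `&` c) * e = (a * b * e) `&` (a * c * e).
Proof. by apply: functional_extensionality_dep => i; apply: mulg_meet. Qed.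

HB.instance Definition _ :=
  isDLMonoid.Build d dlprod dlprod_mulg_join dlprod_mulg_meet.

End DirectProduct.

Definition dl_subalgebra (d : Order.disp_t) (M : dlMonoidType d) (B : set M) :
    Prop :=
  [/\ B 1,
      forall x y, B x -> B y -> B (x * y),
      forall x y, B x -> B y -> B (x `&` y) &
      forall x y, B x -> B y -> B (x `|` y)].

Definition subdirect_product (d : Order.disp_t) (I : Type)
    (T : I -> dlMonoidType d) (B : set (dlprod T)) : Prop :=
  dl_subalgebra B /\ forall i (t : T i), exists2 x : dlprod T, B x & x i = t.

(* The display d carries no mathematical content, so taking the same one for M
   and for the factors is no restriction. *)
Definition representable (d : Order.disp_t) (M : dlMonoidType d) : Prop :=
  exists (I : Type) (T : I -> totalMonoidType d) (B : set (dlprod T)),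
    subdirect_product B /\
    exists f : M -> dlprod T,
      [/\ dlmonoid_morphism f, injective f & range f = B].

(* Prime lattice ideals are nonempty and proper. *)
Record primeIdeal (d : Order.disp_t) (L : latticeType d) := PrimeIdeal {
  primeIdeal_set :> L -> Prop;
  primeIdeal_nonempty : exists a, primeIdeal_set a;
  primeIdeal_proper : exists a, ~ primeIdeal_set a;
  primeIdeal_down : forall a b, a <= b -> primeIdeal_set b -> primeIdeal_set a;
  primeIdeal_join :
    forall a b, primeIdeal_set a -> primeIdeal_set b -> primeIdeal_set (a `|` b);
  primeIdeal_prime :
    forall a b, primeIdeal_set (a `&` b) -> primeIdeal_set a \/ primeIdeal_set b
}.

Section Quotient.
Context {d : Order.disp_t} {M : dlMonoidType d} (I : primeIdeal M).
Implicit Types a b c e : M.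

Definition ideal_frac a : set (M * M) :=
  [set p | I (p.1 * a * p.2)]%classic.

Definition ideal_sim a b : bool := `[< ideal_frac a = ideal_frac b >].

Fact ideal_sim_refl : reflexive ideal_sim.
Proof. by move=> a; apply/asboolP. Qed.
Fact ideal_sim_sym : symmetric ideal_sim.
Proof. by move=> a b; apply/asboolP/asboolP => ->. Qed.
Fact ideal_sim_trans : transitive ideal_sim.
Proof.
by move=> b a c /asboolP ab /asboolP bc; apply/asboolP; rewrite ab.
Qed.

Canonical ideal_sim_equiv :=
  EquivRel ideal_sim ideal_sim_refl ideal_sim_sym ideal_sim_trans.

Fact ideal_simP a b :
  reflect (forall c e, I (c * a * e) <-> I (c * b * e)) (ideal_sim a b).
Proof.
apply: (iffP (asboolP _)) => [ab c e|ab].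
  by have : ideal_frac a (c, e) <-> ideal_frac b (c, e) by rewrite ab.
by apply/seteqP; split=> -[c e] /= /ab.
Qed.

Fact primeIdealU a b : I (a `|` b) <-> I a /\ I b.
Proof.
split=> [Iab|[]]; last exact: primeIdeal_join.
by split; apply: primeIdeal_down Iab; rewrite ?leUl ?leUr.
Qed.

Fact primeIdealI a b : I (a `&` b) <-> I a \/ I b.
Proof.
split; first exact: primeIdeal_prime.
by case; apply: primeIdeal_down; rewrite ?leIl ?leIr.
Qed.

Fact ideal_sim_mul a a' b b' :
  ideal_sim a a' -> ideal_sim b b' -> ideal_sim (a * b) (a' * b').
Proof.
move=> /ideal_simP aa' /ideal_simP bb'; apply/ideal_simP => c e.
have -> : c * (a * b) * e = c * a * (b * e) by rewrite !mulgA.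
have -> : c * (a' * b') * e = c * a' * b' * e by rewrite !mulgA.
by rewrite aa' mulgA bb'.
Qed.

Fact ideal_sim_meet a a' b b' :
  ideal_sim a a' -> ideal_sim b b' -> ideal_sim (a `&` b) (a' `&` b').
Proof.
move=> /ideal_simP aa' /ideal_simP bb'; apply/ideal_simP => c e.
by rewrite !mulg_meet !primeIdealI aa' bb'.
Qed.

Fact ideal_sim_join a a' b b' :
  ideal_sim a a' -> ideal_sim b b' -> ideal_sim (a `|` b) (a' `|` b').
Proof.
move=> /ideal_simP aa' /ideal_simP bb'; apply/ideal_simP => c e.
by rewrite !mulg_join !primeIdealU aa' bb'.
Qed.

Definition dlquot : Type := {eq_quot ideal_sim_equiv}.

HB.instance Definition _ := Choice.on dlquot.
HB.instance Definition _ := EqQuotient.on dlquot.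

Implicit Types x y z : dlquot.

Definition dlquot_mul := lift_op2 dlquot (fun a b => a * b).
Definition dlquot_one := lift_cst dlquot 1.
Definition dlquot_meet := lift_op2 dlquot (fun a b => a `&` b).
Definition dlquot_join := lift_op2 dlquot (fun a b => a `|` b).
Definition dlquot_le x y : bool := dlquot_meet x y == x.
Definition dlquot_lt x y : bool := (y != x) && dlquot_le x y.

Fact ideal_sim_repr a : ideal_sim a (repr (\pi_dlquot a)).
Proof. by rewrite -(@eqmodE _ ideal_sim_equiv) reprK. Qed.

Fact pi_dlquot_mul : {morph \pi_dlquot : a b / a * b >-> dlquot_mul a b}.
Proof.
move=> a b; unlock dlquot_mul; apply/eqP; rewrite eqmodE.
exact: ideal_sim_mul (ideal_sim_repr a) (ideal_sim_repr b).
Qed.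
Fact pi_dlquot_meet : {morph \pi_dlquot : a b / a `&` b >-> dlquot_meet a b}.
Proof.
move=> a b; unlock dlquot_meet; apply/eqP; rewrite eqmodE.
exact: ideal_sim_meet (ideal_sim_repr a) (ideal_sim_repr b).
Qed.
Fact pi_dlquot_join : {morph \pi_dlquot : a b / a `|` b >-> dlquot_join a b}.
Proof.
move=> a b; unlock dlquot_join; apply/eqP; rewrite eqmodE.
exact: ideal_sim_join (ideal_sim_repr a) (ideal_sim_repr b).
Qed.

Canonical pi_dlquot_mul_morph := PiMorph2 pi_dlquot_mul.
Canonical pi_dlquot_one_morph := PiConst dlquot_one.
Canonical pi_dlquot_meet_morph := PiMorph2 pi_dlquot_meet.
Canonical pi_dlquot_join_morph := PiMorph2 pi_dlquot_join.

Fact dlquot_mulA : associative dlquot_mul.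
Proof. by elim/quotW=> a; elim/quotW=> b; elim/quotW=> c; rewrite !piE mulgA. Qed.
Fact dlquot_mul1 : left_id dlquot_one dlquot_mul.
Proof. by elim/quotW=> a; rewrite !piE mul1g. Qed.
Fact dlquot_mulr1 : right_id dlquot_one dlquot_mul.
Proof. by elim/quotW=> a; rewrite !piE mulg1. Qed.

HB.instance Definition _ :=
  isMonoid.Build dlquot dlquot_mulA dlquot_mul1 dlquot_mulr1.

Fact dlquot_meetC : commutative dlquot_meet.
Proof. by elim/quotW=> a; elim/quotW=> b; rewrite !piE meetC. Qed.
Fact dlquot_joinC : commutative dlquot_join.
Proof. by elim/quotW=> a; elim/quotW=> b; rewrite !piE joinC. Qed.
Fact dlquot_meetA : associative dlquot_meet.
Proof. by elim/quotW=> a; elim/quotW=> b; elim/quotW=> c; rewrite !piE meetA. Qed.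
Fact dlquot_joinA : associative dlquot_join.
Proof. by elim/quotW=> a; elim/quotW=> b; elim/quotW=> c; rewrite !piE joinA. Qed.
Fact dlquot_joinKI y x : dlquot_meet x (dlquot_join x y) = x.
Proof. by elim/quotW: x => a; elim/quotW: y => b; rewrite !piE joinKI. Qed.
Fact dlquot_meetKU y x : dlquot_join x (dlquot_meet x y) = x.
Proof. by elim/quotW: x => a; elim/quotW: y => b; rewrite !piE meetKU. Qed.
Fact dlquot_meetUl : left_distributive dlquot_meet dlquot_join.
Proof. by elim/quotW=> a; elim/quotW=> b; elim/quotW=> c; rewrite !piE meetUl. Qed.
Fact dlquot_meetxx : idempotent_op dlquot_meet.
Proof. by elim/quotW=> a; rewrite !piE meetxx. Qed.

HB.instance Definition _ :=
  Order.isMeetJoinDistrLattice.Build d dlquot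
    (fun _ _ => erefl) (fun _ _ => erefl) dlquot_meetC dlquot_joinC
    dlquot_meetA dlquot_joinA dlquot_joinKI dlquot_meetKU dlquot_meetUl
    dlquot_meetxx.

Fact dlquot_pi1 : \pi_dlquot (1 : M) = 1 :> dlquot.
Proof. by change (\pi_dlquot (1 : M) = dlquot_one); rewrite !piE. Qed.
Fact dlquot_piM : {morph (\pi_dlquot : M -> dlquot) : a b / a * b}.
Proof. exact: pi_dlquot_mul. Qed.
Fact dlquot_piI : {morph (\pi_dlquot : M -> dlquot) : a b / a `&` b}.
Proof. exact: pi_dlquot_meet. Qed.
Fact dlquot_piU : {morph (\pi_dlquot : M -> dlquot) : a b / a `|` b}.
Proof. exact: pi_dlquot_join. Qed.

Fact dlquot_mulg_join x y z t :
  x * (y `|` z) * t = (x * y * t) `|` (x * z * t).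
Proof.
elim/quotW: x => a; elim/quotW: y => b; elim/quotW: z => c; elim/quotW: t => e.
by rewrite -!(dlquot_piU, dlquot_piM) mulg_join.
Qed.
Fact dlquot_mulg_meet x y z t :
  x * (y `&` z) * t = (x * y * t) `&` (x * z * t).
Proof.
elim/quotW: x => a; elim/quotW: y => b; elim/quotW: z => c; elim/quotW: t => e.
by rewrite -!(dlquot_piI, dlquot_piM) mulg_meet.
Qed.

HB.instance Definition _ :=
  isDLMonoid.Build d dlquot dlquot_mulg_join dlquot_mulg_meet.

End Quotient.

Arguments dlquot {d M} I.

(* Main.v *)
Require Import Defs.
From HB Require Import structures.
From mathcomp Require Import all_boot all_order.
From mathcomp Require Import boolp classical_sets.
Import Order.Theory.
Local Open Scope order_scope.
Local Open Scope group_scope.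

(** A totally ordered monoid satisfies the quasiequation because [y1] and [y2]
    are comparable there: if [y1 <= y2], then [z1 * y1 * z2 <= z1 * y2 * z2],
    and otherwise [w1 * y2 * w2 <= w1 * y1 * w2].  Quasiequations pass to
    products and, along injective morphisms, to subalgebras, so representable
    algebras satisfy it too ([representable_quasieq]).  Putting the two sides
    of the equation for [x1] and [x2] in the quasiequation gives the equation.

    For a prime ideal [I], the equation makes the sets [I/a] (the
    [ideal_frac I a]) a chain.  If [I/a] and [I/b] were incomparable, there
    would be [c * a * e] and [c' * b * e'] in [I] with [c * b * e] and
    [c' * a * e'] outside [I]; the equation puts the meet of the last two
    elements below the join of the first two, so primality is contradicted
    ([ideal_frac_chain]).  Since [I] is prime, meets in the quotient correspond to unions of the sets [I/a]; so
    inclusion of these sets is the reverse of the order of [M/I], which is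
    therefore total.

    Finally, [M] maps to the product of its quotients [M/I] over all prime
    ideals [I], and the image is subdirect since each projection is onto.  The
    map is injective by the prime ideal theorem for distributive lattices
    ([prime_ideal_separation]): if [a] is not below [b], some prime ideal [I]
    contains [b] but not [a], and then the pair [(1, 1)] distinguishes [I/a]
    from [I/b]. *)

(** Zorn's lemma gives an ideal [J] maximal among those that contain [b] and
    avoid [a].  It is prime: if [x] and [y] are outside [J], the ideals
    generated by [J] with [x], and by [J] with [y], both contain [a], so that
    [a] is below [(u `|` x) `&` (u `|` y) = u `|` (x `&` y)] for some [u] in
    [J], whence [x `&` y] is outside [J]. *)
Lemma prime_ideal_separation (d : Order.disp_t) (L : distrLatticeType d)
    (a b : L) :
  ~~ (a <= b) -> exists I : primeIdeal L, I b /\ ~ I a.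
Proof.
move=> Nab.
(* Asking that [A] contain [b] only when it is nonempty lets the empty chain,
   whose union is empty, satisfy the hypothesis of Zorn's lemma. *)
pose P (A : L -> Prop) :=
  [/\ forall x y, x <= y -> A y -> A x,
      forall x y, A x -> A y -> A (x `|` y),
      ~ A a & forall x, A x -> A b].
have [F FP Ftot|J [[Jdown Jjoin JNa Jb'] Jmax]] := @Zorn_bigcup L P.
  split.
  - move=> x y xy [A FA Ay]; exists A => //.
    by have [down _ _ _] := FP _ FA; apply: down xy Ay.
  - move=> x y [A FA Ax] [B FB By].
    have [AB|BA] := Ftot _ _ FA FB.
      by exists B => //; have [_ join _ _] := FP _ FB; apply: join => //; apply: AB.
    by exists A => //; have [_ join _ _] := FP _ FA; apply: join => //; apply: BA.
  - by move=> [A FA Aa]; have [_ _ /(_ Aa)] := FP _ FA.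
  - move=> x [A FA Ax]; exists A => //; have [_ _ _ h] := FP _ FA; exact: h Ax.
have Jb : J b.
  apply: contrapT => NJb.
  have NJ x : ~ J x by move=> /Jb'.
  apply: (Jmax (fun x => x <= b)).
    by split=> [x /NJ//|/(_ b (lexx b))].
  split=> [x y||/=|//].
  - exact: le_trans.
  - by move=> x y; rewrite leUx => -> ->.
  - exact/negP.
(* By maximality, the ideal generated by [J] and [x] contains [a]. *)
have Jext x : ~ J x -> exists2 u, J u & a <= u `|` x.
  move=> NJx; apply: contrapT => Na.
  pose K y := exists2 u, J u & y <= u `|` x.
  apply: (Jmax K).
    split=> [y Jy|KJ]; first by exists y; rewrite ?leUl.
    by apply/NJx/KJ; exists b; rewrite ?leUr.
  split=> // [y z yz [u Ju zu]|y z [u Ju yu] [v Jv zv]|y _].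
  - by exists u => //; apply: le_trans yz zu.
  - exists (u `|` v); first exact: Jjoin.
    by rewrite -[x]joinxx joinACA leU2.
  - by exists b; rewrite ?leUl.
have Jprime x y : J (x `&` y) -> J x \/ J y.
  move=> Jxy; apply: contrapT => /not_orP[/Jext[u Ju au] /Jext[v Jv av]].
  apply: JNa; apply: (Jdown _ (u `|` v `|` (x `&` y))); last first.
    exact: Jjoin (Jjoin _ _ Ju Jv) Jxy.
  rewrite joinIr lexI (le_trans au) ?(le_trans av) //.
    by rewrite leU2 ?leUr.
  by rewrite leU2 ?leUl.
by exists (PrimeIdeal (ex_intro _ b Jb) (ex_intro _ a JNa) Jdown Jjoin Jprime).
Qed.

Lemma mulg_le (d : Order.disp_t) (M : dlMonoidType d) (a b c e : M) :
  b <= c -> a * b * e <= a * c * e.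
Proof. by rewrite !leEmeet -mulg_meet => /eqP ->. Qed.

Lemma dlprod_leP (d : Order.disp_t) (I : Type) (T : I -> dlMonoidType d)
    (x y : dlprod T) :
  x <= y <-> forall i, x i <= y i.
Proof.
rewrite leEmeet; split=> [/eqP xy i|xy]; first by rewrite leEmeet -{2}xy.
apply/eqP; apply: functional_extensionality_dep => i.
exact/meet_l/xy.
Qed.

Lemma representable_quasieq (d : Order.disp_t) (M : dlMonoidType d) :
  representable M ->
  forall x1 x2 y1 y2 z1 z2 w1 w2 : M,
    x1 <= x2 `|` (z1 * y1 * z2) -> x1 <= x2 `|` (w1 * y2 * w2) ->
    x1 <= x2 `|` (z1 * y2 * z2) `|` (w1 * y1 * w2).
Proof.
move=> [I [T [_ [_ [f [[[_ fM] fI fU] finj _]]]]]] x1 x2 y1 y2 z1 z2 w1 w2.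
have f_le a b : (a <= b) = (f a <= f b).
  by rewrite !leEmeet -fI (inj_eq finj).
rewrite !{}f_le !fU !fM => /dlprod_leP h1 /dlprod_leP h2.
apply/dlprod_leP => i; case/orP: (le_total (f y1 i) (f y2 i)) => y12.
- apply: le_trans (h1 i) (le_trans _ (leUl _ _)).
  exact/(leU2 (lexx _))/mulg_le.
- apply: le_trans (h2 i) _.
  exact/(leU2 (leUl _ _))/mulg_le.
Qed.

Lemma ideal_frac_chain (d : Order.disp_t) (M : dlMonoidType d)
    (I : primeIdeal M) :
  (forall y1 y2 z1 z2 w1 w2 : M,
     (z1 * y1 * z2) `&` (w1 * y2 * w2) <= (z1 * y2 * z2) `|` (w1 * y1 * w2)) ->
  forall a b, (ideal_frac I a `<=` ideal_frac I b)%classic \/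
              (ideal_frac I b `<=` ideal_frac I a)%classic.
Proof.
move=> eqM a b; apply: contrapT => /not_orP[].
move=> /existsNP[[c e] /not_implyP[Iaz NIbz]].
move=> /existsNP[[c' e'] /not_implyP[Ibw NIaw]].
have := primeIdeal_down (eqM b a c e c' e') (primeIdeal_join Iaz Ibw).
by move=> /primeIdealI[].
Qed.

Lemma pi_dlquot_le (d : Order.disp_t) (M : dlMonoidType d) (I : primeIdeal M)
    (a b : M) :
  (ideal_frac I b `<=` ideal_frac I a)%classic ->
  \pi_(dlquot I)%qT a <= \pi_(dlquot I)%qT b.
Proof.
move=> ba; rewrite leEmeet -dlquot_piI; apply/eqP/eqmodP/ideal_simP => c e.
rewrite mulg_meet primeIdealI; split=> [[//|]|]; last by left.
exact: (ba (c, e)).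
Qed.

Lemma equation_quot_total (d : Order.disp_t) (M : dlMonoidType d) :
  (forall y1 y2 z1 z2 w1 w2 : M,
     (z1 * y1 * z2) `&` (w1 * y2 * w2) <= (z1 * y2 * z2) `|` (w1 * y1 * w2)) ->
  forall I : primeIdeal M, total (<=%O : rel (dlquot I)).
Proof.
move=> eqM I; elim/quotW=> a; elim/quotW=> b; apply/orP.
by have [ab|ba] := ideal_frac_chain _ _ I eqM a b; [right|left]; apply: pi_dlquot_le.
Qed.

Lemma pi_dlquot_separates (d : Order.disp_t) (M : dlMonoidType d) (a b : M) :
  (forall I : primeIdeal M, \pi_(dlquot I)%qT a = \pi_(dlquot I)%qT b) -> a = b.
Proof.
suff le x y : (forall I : primeIdeal M,
    \pi_(dlquot I)%qT x = \pi_(dlquot I)%qT y) -> x <= y.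
  by move=> ab; apply/le_anti; rewrite !le.
move=> xy; apply: contrapT => /negP/prime_ideal_separation[I [Iy NIx]].
have /eqmodP/ideal_simP/(_ 1 1) := xy I.
by rewrite !mul1g !mulg1 => -[_ /(_ Iy)].
Qed.

Lemma quot_total_representable (d : Order.disp_t) (M : dlMonoidType d) :
  (forall I : primeIdeal M, total (<=%O : rel (dlquot I))) -> representable M.
Proof.
move=> tot.
pose T (I : primeIdeal M) : totalMonoidType d :=
  HB.pack_for (totalMonoidType d) (dlquot I)
    (Order.DistrLattice_isTotal.Build d (dlquot I) (tot I)).
pose f (a : M) : dlprod T := fun I => \pi_(dlquot I)%qT a.
have fM : {morph f : a b / a * b}.
  by move=> a b; apply: functional_extensionality_dep => I; apply: dlquot_piM.
have fI : {morph f : a b / a `&` b}.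
  by move=> a b; apply: functional_extensionality_dep => I; apply: dlquot_piI.
have fU : {morph f : a b / a `|` b}.
  by move=> a b; apply: functional_extensionality_dep => I; apply: dlquot_piU.
have f1 : f 1 = 1.
  by apply: functional_extensionality_dep => I; apply: dlquot_pi1.
exists (primeIdeal M), T, (range f); split.
  split; first split.
  - by exists 1.
  - by move=> _ _ [a _ <-] [b _ <-]; exists (a * b).
  - by move=> _ _ [a _ <-] [b _ <-]; exists (a `&` b).
  - by move=> _ _ [a _ <-] [b _ <-]; exists (a `|` b).
  by move=> I; elim/quotW=> a; exists (f a) => //; exists a.
exists f; split=> // a b fab; apply: pi_dlquot_separates => I.
exact: (congr1 (fun x : dlprod T => x I) fab).
Qed.

Theorem proposition5p4 (d : Order.disp_t) (M : dlMonoidType d) :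
  [<-> representable M;
       forall x1 x2 y1 y2 z1 z2 w1 w2 : M,
         x1 <= x2 `|` (z1 * y1 * z2) -> x1 <= x2 `|` (w1 * y2 * w2) ->
         x1 <= x2 `|` (z1 * y2 * z2) `|` (w1 * y1 * w2);
       forall y1 y2 z1 z2 w1 w2 : M,
         (z1 * y1 * z2) `&` (w1 * y2 * w2)
           <= (z1 * y2 * z2) `|` (w1 * y1 * w2);
       forall I : primeIdeal M, total (<=%O : rel (dlquot I)) ].
Proof.
tfae.
- exact: representable_quasieq.
- move=> quasi y1 y2 z1 z2 w1 w2.
  set lhs := (X in X <= _); set rhs := (X in _ <= X).
  have -> : rhs = rhs `|` (z1 * y2 * z2) `|` (w1 * y1 * w2) by rewrite -joinA joinxx.
  by apply: quasi; apply: lexUr; rewrite ?leIl ?leIr.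
- exact: equation_quot_total.
- exact: quot_total_representable.
Qed.
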